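(* Let $n \geq 3$. Let $F \colon \mathbf{PBoolean}^{\mathrm{op}} \to \mathbf{Loc}$ be any functor that assigns to each Boolean algebra its Stone spectrum, i.e. the restriction of $F$ to $\mathbf{Boolean}^{\mathrm{op}}$ is the Stone spectrum functor $\mathbf{Boolean}^{\mathrm{op}} \to \mathbf{Loc}$ (up to natural isomorphism). Then $F$ trivializes on the partial Boolean algebra $\mathrm{Proj}(\mathbb{M}_n(\mathbb{C}))$ of projections in the $n$-by-$n$ complex matrices: $F(\mathrm{Proj}(\mathbb{M}_n(\mathbb{C})))$ is an initial object of $\mathbf{Loc}$, that is, isomorphic to the locale of opens of the empty topological space.
   Context: A partial Boolean algebra consists of a set $B$ with a reflexive and symmetric binary (commeasurability) relation $\odot \subseteq B \times B$; elements $0,1 \in B$; a (total) unary operation $\lnot \colon B \to B$; and (partial) binary operations $\land, \lor \colon \odot \to B$; such that every set $S \subseteq B$ of pairwise commeasurable elements is contained in a set $T \subseteq B$, whose elements are also pairwise commeasurable, and on which the elements $0,1$ and the operations $\lnot, \land, \lor$ determine a Boolean algebra structure. A morphism of partial Boolean algebras is a function $f$ satisfying: $f(a) \odot f(b)$ whenever $a \odot b$; $f(0)=0$ and $f(1)=1$; $f(a \lor b) = f(a) \lor f(b)$ and $f(a \land b) = f(a) \land f(b)$ whenever $a \odot b$; $f(\lnot a) = \lnot f(a)$ for all $a$. These form the category $\mathbf{PBoolean}$. The category $\mathbf{Boolean}$ of Boolean algebras is regarded as its full subcategory of those partial Boolean algebras whose commeasurability relation is total (the Boolean algebra with $0=1$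 is allowed). $\mathrm{Proj}(\mathbb{M}_n(\mathbb{C})) = \{ p \in \mathbb{M}_n(\mathbb{C}) \mid p^*p = p \}$ is a partial Boolean algebra in which two projections are commeasurable when they commute, and $p \land q = pq$, $p \lor q = p+q-pq$, $\lnot p = 1-p$. A locale is a complete lattice $L$ satisfying $\bigvee_i (x \wedge y_i) = x \wedge \bigvee_i y_i$. A morphism of locales $K \to L$ is a function $f \colon L \to K$ preserving finite meets (including the top element) and arbitrary joins. These form the category $\mathbf{Loc}$, whose initial object is the one-element lattice. The Stone spectrum of a Boolean algebra $B$ is the locale $\mathrm{Idl}(B)$ of ideals of $B$ ordered by inclusion (the locale of open sets of the space of ultrafilters of $B$). A Boolean homomorphism $f \colon B \to B'$ induces a locale morphism $\mathrm{Idl}(B') \to \mathrm{Idl}(B)$, given by the function sending an ideal $I$ of $B$ to the down closure of $f(I)$. *)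

(* Defs.v *)
From HB Require Import structures.
From mathcomp Require Import all_boot all_order all_algebra.
From mathcomp Require Import sesquilinear spectral complex.
From mathcomp Require Import boolp classical_sets reals topology.

Set Implicit Arguments.
Unset Strict Implicit.
Unset Printing Implicit Defensive.

Import GRing.Theory Num.Theory.

Local Open Scope classical_set_scope.
Local Open Scope ring_scope.
Local Open Scope sesquilinear_scope.

Record category := Category {
  obj :> Type;
  hom : obj -> obj -> Type;
  cat_id : forall X, hom X X;
  cat_comp : forall X Y Z, hom Y Z -> hom X Y -> hom X Z;
  cat_comp_idl : forall X Y (f : hom X Y), cat_comp (cat_id Y) f = f;
  cat_comp_idr : forall X Y (f : hom X Y), cat_comp f (cat_id X) = f;
  cat_compA : forall X Y Z W (h : hom Z W) (g : hom Y Z) (f : hom X Y),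
    cat_comp h (cat_comp g f) = cat_comp (cat_comp h g) f }.

Arguments hom {c} _ _.
Arguments cat_id {c} _.
Arguments cat_comp {c X Y Z} _ _.

Definition opposite (C : category) : category :=
  @Category C (fun X Y => @hom C Y X) (@cat_id C)
    (fun X Y Z g f => cat_comp f g)
    (fun X Y f => cat_comp_idr f) (fun X Y f => cat_comp_idl f)
    (fun X Y Z W h g f => esym (cat_compA f g h)).

Record functor (C D : category) := Functor {
  fobj :> C -> D;
  fmap : forall X Y : C, hom X Y -> hom (fobj X) (fobj Y);
  fmap_id : forall X : C, fmap (cat_id X) = cat_id (fobj X);
  fmap_comp : forall (X Y Z : C) (g : hom Y Z) (f : hom X Y),
    fmap (cat_comp g f) = cat_comp (fmap g) (fmap f) }.

Definition functor_comp (C D E : category)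
    (G : functor D E) (F : functor C D) : functor C E.
Proof.
refine (@Functor C E (fun X => G (F X)) (fun X Y f => fmap G (fmap F f)) _ _).
- by move=> X; rewrite !fmap_id.
- by move=> X Y Z g f; rewrite !fmap_comp.
Defined.

Definition functor_op (C D : category) (F : functor C D) :
    functor (opposite C) (opposite D) :=
  @Functor (opposite C) (opposite D) F (fun X Y f => @fmap C D F Y X f)
    (fmap_id F) (fun X Y Z g f => fmap_comp F f g).

Definition is_iso (C : category) (X Y : C) (f : hom X Y) : Prop :=
  exists g : hom Y X, cat_comp g f = cat_id X /\ cat_comp f g = cat_id Y.

Definition isomorphic (C : category) (X Y : C) : Prop :=
  exists f : hom X Y, is_iso f.

Definition is_initial (C : category) (X : C) : Prop :=
  forall Y : C, exists! f : hom X Y, True.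

Definition naturally_isomorphic (C D : category) (F G : functor C D) : Prop :=
  exists eta : forall X : C, hom (F X) (G X),
    (forall X, is_iso (eta X)) /\
    (forall (X Y : C) (f : hom X Y),
       cat_comp (eta Y) (fmap F f) = cat_comp (fmap G f) (eta X)).

Record is_boolean_algebra (X : Type) (zero one : X) (neg : X -> X)
    (meet join : X -> X -> X) : Prop := IsBooleanAlgebra {
  ba_meetC : commutative meet;
  ba_joinC : commutative join;
  ba_meetA : associative meet;
  ba_joinA : associative join;
  ba_meetK : forall a b, meet a (join a b) = a;
  ba_joinK : forall a b, join a (meet a b) = a;
  ba_meetU : right_distributive meet join;
  ba_meet1 : right_id one meet;
  ba_join0 : right_id zero join;
  ba_meetN : forall a, meet a (neg a) = zero;
  ba_joinN : forall a, join a (neg a) = one }.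

(* The partial operations take a proof of commeasurability; their value does
   not depend on it, by proof irrelevance (pandE, porE below). *)
Record pba_data := PBAData {
  pba_car :> Type;
  pcom : pba_car -> pba_car -> Prop;
  pzero : pba_car;
  pone : pba_car;
  pneg : pba_car -> pba_car;
  pand : forall a b, pcom a b -> pba_car;
  por : forall a b, pcom a b -> pba_car }.

Arguments pzero {p}.
Arguments pone {p}.
Arguments pand {p} a b _.
Arguments por {p} a b _.

Definition pairwise_com (B : pba_data) (S : set B) : Prop :=
  forall a b, S a -> S b -> pcom a b.

(* The constants and operations of B restrict to T and make it a Boolean
   algebra. *)
Definition boolean_on (B : pba_data) (T : set B) : Prop :=
  exists (zero one : {x : B | T x}) (neg : {x : B | T x} -> {x : B | T x})
         (meet join : {x : B | T x} -> {x : B | T x} -> {x : B | T x}),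
  [/\ sval zero = pzero /\ sval one = pone,
      forall a, sval (neg a) = pneg (sval a),
      forall a b (h : pcom (sval a) (sval b)),
        sval (meet a b) = pand (sval a) (sval b) h,
      forall a b (h : pcom (sval a) (sval b)),
        sval (join a b) = por (sval a) (sval b) h
    & is_boolean_algebra zero one neg meet join].

Record pba := PBA {
  pba_of :> pba_data;
  pcom_refl : forall a : pba_of, pcom a a;
  pcom_sym : forall a b : pba_of, pcom a b -> pcom b a;
  pba_boolean : forall S : set pba_of, pairwise_com S ->
    exists T : set pba_of, [/\ S `<=` T, pairwise_com T & boolean_on T] }.

Record pba_hom (A B : pba) := PBAHom {
  pba_fun :> A -> B;
  pba_fun_com : forall a b, pcom a b -> pcom (pba_fun a) (pba_fun b);
  pba_fun0 : pba_fun pzero = pzero;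
  pba_fun1 : pba_fun pone = pone;
  pba_funU : forall a b (h : pcom a b),
    pba_fun (por a b h) = por (pba_fun a) (pba_fun b) (pba_fun_com h);
  pba_funI : forall a b (h : pcom a b),
    pba_fun (pand a b h) = pand (pba_fun a) (pba_fun b) (pba_fun_com h);
  pba_funN : forall a, pba_fun (pneg a) = pneg (pba_fun a) }.

Lemma pba_hom_eq (A B : pba) (f g : pba_hom A B) : f =1 g -> f = g.
Proof.
case: f g => [f fc f0 f1 fU fI fN] [g gc g0 g1 gU gI gN] /= /funext fg.
subst g; have e := Prop_irrelevance fc gc; subst gc.
by congr PBAHom; exact: Prop_irrelevance.
Qed.

Definition pba_id (A : pba) : pba_hom A A :=
  @PBAHom A A id (fun a b h => h) erefl erefl
    (fun a b h => erefl) (fun a b h => erefl) (fun a => erefl).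

Definition pba_comp (A B C : pba) (g : pba_hom B C) (f : pba_hom A B) :
  pba_hom A C.
Proof.
refine (@PBAHom A C (fun a => g (f a))
  (fun a b h => pba_fun_com g (pba_fun_com f h)) _ _ _ _ _).
- by rewrite !pba_fun0.
- by rewrite !pba_fun1.
- by move=> a b h; rewrite !pba_funU.
- by move=> a b h; rewrite !pba_funI.
- by move=> a; rewrite !pba_funN.
Defined.

Definition PBoolean : category.
Proof.
refine (@Category pba pba_hom pba_id pba_comp _ _ _) => *; exact: pba_hom_eq.
Defined.

Record boolean_algebra := BooleanAlgebra {
  ba_pba :> pba;
  ba_total : forall a b : ba_pba, pcom a b }.

(* A full subcategory of PBoolean: homs are all morphisms of partial Boolean
   algebras. *)
Definition Boolean : category.
Proof.
refine (@Category boolean_algebra (fun A B => pba_hom A B)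
  (fun A => pba_id A) (fun A B C g f => pba_comp g f) _ _ _) => *;
exact: pba_hom_eq.
Defined.

Definition Boolean_incl : functor Boolean PBoolean :=
  @Functor Boolean PBoolean ba_pba (fun A B f => f)
    (fun A => erefl) (fun A B C g f => erefl).

Definition band (B : boolean_algebra) (a b : B) : B := pand a b (ba_total a b).
Definition bor (B : boolean_algebra) (a b : B) : B := por a b (ba_total a b).
Definition ble (B : boolean_algebra) (a b : B) : Prop := band a b = a.

Lemma pandE (B : pba) (a b : B) (h h' : pcom a b) : pand a b h = pand a b h'.
Proof. by rewrite (Prop_irrelevance h h'). Qed.

Lemma porE (B : pba) (a b : B) (h h' : pcom a b) : por a b h = por a b h'.
Proof. by rewrite (Prop_irrelevance h h'). Qed.

Lemma boolean_algebraP (B : boolean_algebra) :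
  is_boolean_algebra (@pzero B) pone (@pneg B) (@band B) (@bor B).
Proof.
have [|T [ST _]] := @pba_boolean B setT; first by move=> a b _ _; exact: ba_total.
case=> z [o [neg [mt [jn [[z0 o1] negE mtE jnE]]]]].
have inT x : T x by exact: ST.
pose i (x : B) : {x : B | T x} := exist _ x (inT x).
have iE x (y : {x : B | T x}) : x = sval y -> i x = y.
  by case: y => y Ty /= ->; exact: eq_exist.
have mE a b : band a b = sval (mt (i a) (i b)).
  by rewrite (mtE (i a) (i b) (ba_total _ _)).
have jE a b : bor a b = sval (jn (i a) (i b)).
  by rewrite (jnE (i a) (i b) (ba_total _ _)).
have iK y : i (sval y) = y by exact: iE.
have nE a : pneg a = sval (neg (i a)) by rewrite negE.
case=> mC jC mA jA mK jK mU m1 j0 mN jN.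
split.
- by move=> a b; rewrite !mE mC.
- by move=> a b; rewrite !jE jC.
- by move=> a b c; rewrite !mE !iK mA.
- by move=> a b c; rewrite !jE !iK jA.
- by move=> a b; rewrite !mE !jE !iK mK.
- by move=> a b; rewrite !jE !mE !iK jK.
- by move=> a b c; rewrite !mE !jE !iK mU.
- by move=> a; rewrite !mE -o1 iK m1.
- by move=> a; rewrite !jE -z0 iK j0.
- by move=> a; rewrite !mE nE iK mN.
- by move=> a; rewrite !jE nE iK jN.
Qed.

Definition is_proj (R : realType) (n : nat) (p : 'M[R[i]]_n) : Prop :=
  p ^t* *m p = p.

Definition proj (R : realType) (n : nat) : Type :=
  {p : 'M[R[i]]_n | is_proj p}.

Definition mx_of_proj (R : realType) (n : nat) (p : proj R n) : 'M[R[i]]_n :=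
  sval p.
Coercion mx_of_proj : proj >-> matrix.

Section ProjLemmas.
Context (R : realType) (n : nat).
Implicit Types p q r : 'M[R[i]]_n.

Lemma is_projP p : is_proj p <-> p ^t* = p /\ p *m p = p.
Proof.
rewrite /is_proj; split=> [pP|[{1}-> //]].
have pA : p ^t* = p.
  by rewrite -{1}pP trmx_mul map_mxM map_trmx trmxK -map_mx_comp
    (map_mx_id (@conjCK _)) pP.
by split=> //; rewrite -{1}pA.
Qed.

Lemma is_proj0 : is_proj (0 : 'M[R[i]]_n).
Proof. by rewrite /is_proj mulmx0. Qed.

Lemma is_proj1 : is_proj (1%:M : 'M[R[i]]_n).
Proof. by rewrite /is_proj mulmx1 trmx1 map_mx1. Qed.

Lemma is_projN p : is_proj p -> is_proj (1%:M - p).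
Proof.
move=> /is_projP [pA pp]; apply/is_projP; split.
  by rewrite linearB /= trmx1 map_mxB map_mx1 pA.
by rewrite mulmxBr mulmx1 mulmxBl mul1mx pp subrr subr0.
Qed.

Lemma is_projI p q : is_proj p -> is_proj q -> p *m q = q *m p ->
  is_proj (p *m q).
Proof.
move=> /is_projP [pA pp] /is_projP [qA qq] pq; apply/is_projP; split.
  by rewrite trmx_mul map_mxM pA qA.
by rewrite -mulmxA [q *m _]mulmxA -pq -!mulmxA qq mulmxA pp.
Qed.

Lemma projUE p q : p + q - p *m q = 1%:M - (1%:M - p) *m (1%:M - q).
Proof.
rewrite mulmxBr mulmx1 mulmxBl mul1mx opprD opprK opprB addrA.
by rewrite [1%:M + _]addrC subrK addrA addrAC -addrA addrC -addrA [_ + p]addrC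
  addrA addrC.
Qed.

Lemma commxN p q : p *m q = q *m p -> (1%:M - p) *m q = q *m (1%:M - p).
Proof. by move=> pq; rewrite mulmxBl mulmxBr mul1mx mulmx1 pq. Qed.

Lemma commxI p q r : p *m r = r *m p -> q *m r = r *m q ->
  (p *m q) *m r = r *m (p *m q).
Proof. by move=> pr qr; rewrite -mulmxA qr mulmxA pr mulmxA. Qed.

Lemma is_projU p q : is_proj p -> is_proj q -> p *m q = q *m p ->
  is_proj (p + q - p *m q).
Proof.
move=> pP qP pq; rewrite projUE; apply/is_projN/is_projI; try exact: is_projN.
by apply/commxN/esym/commxN.
Qed.

Lemma mulmxIl p q r : p *m p = p -> p *m q = q *m p ->
  p *m (q *m r) = (p *m q) *m (p *m r).
Proof.
move=> pp pq.
by rewrite [in RHS]pq -[RHS]mulmxA [p *m (p *m r)]mulmxA pp !mulmxA pq.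
Qed.

Lemma projK (p : proj R n) : p *m p = p :> 'M[R[i]]_n.
Proof. by case: p => p /= /is_projP[]. Qed.

Lemma proj_eq (p q : proj R n) : p = q :> 'M[R[i]]_n -> p = q.
Proof. by case: p q => [p hp] [q hq] /= pq; exact: eq_exist. Qed.

End ProjLemmas.

Definition proj_com (R : realType) (n : nat) (p q : proj R n) : Prop :=
  p *m q = q *m p :> 'M[R[i]]_n.

Definition proj_and (R : realType) (n : nat) (p q : proj R n)
    (h : proj_com p q) : proj R n :=
  exist _ (p *m q) (is_projI (svalP p) (svalP q) h).

Definition proj_or (R : realType) (n : nat) (p q : proj R n)
    (h : proj_com p q) : proj R n :=
  exist _ ((p : 'M[R[i]]_n) + q - p *m q) (is_projU (svalP p) (svalP q) h).

Definition proj_not (R : realType) (n : nat) (p : proj R n) : proj R n :=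
  exist _ (1%:M - (p : 'M[R[i]]_n)) (is_projN (svalP p)).

Definition proj_data (R : realType) (n : nat) : pba_data :=
  @PBAData (proj R n) (@proj_com R n)
    (exist _ 0 (is_proj0 R n)) (exist _ 1%:M (is_proj1 R n))
    (@proj_not R n) (@proj_and R n) (@proj_or R n).

(* The witness is the set of projections in the bicommutant of S. *)
Lemma proj_boolean (R : realType) (n : nat) (S : set (proj_data R n)) :
  pairwise_com S ->
  exists T : set (proj_data R n), [/\ S `<=` T, pairwise_com T & boolean_on T].
Proof.
move=> Scom.
pose S' (q : proj R n) := forall s, S s -> proj_com q s.
pose T : set (proj_data R n) := fun p => forall q, S' q -> proj_com p q.
have ST : S `<=` T by move=> s Ss q S'q; apply/esym; exact: S'q.
have Tcom : pairwise_com T.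
  by move=> p q Tp Tq; apply: Tp => s Ss; apply: Tq => t St; exact: Scom.
exists T; split=> //.
have T0 : T pzero by move=> q _; rewrite /proj_com /= mul0mx mulmx0.
have T1 : T pone by move=> q _; rewrite /proj_com /= mul1mx mulmx1.
have TN p : T p -> T (pneg p) by move=> Tp q /Tp pq; exact: commxN.
have TI p q (h : pcom p q) : T p -> T q -> T (pand p q h).
  by move=> Tp Tq r rS; apply: commxI; [exact: Tp|exact: Tq].
have TU p q (h : pcom p q) : T p -> T q -> T (por p q h).
  move=> Tp Tq r rS; rewrite /proj_com /= /mx_of_proj /= projUE.
  by apply/commxN/commxI; apply/commxN; [exact: Tp|exact: Tq].
pose c (a b : {x | T x}) : pcom (sval a) (sval b) := Tcom _ _ (svalP a) (svalP b).
pose meet (a b : {x | T x}) : {x | T x} :=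
  exist _ (pand (sval a) (sval b) (c a b)) (TI _ _ (c a b) (svalP a) (svalP b)).
pose join (a b : {x | T x}) : {x | T x} :=
  exist _ (por (sval a) (sval b) (c a b)) (TU _ _ (c a b) (svalP a) (svalP b)).
pose neg (a : {x | T x}) : {x | T x} := exist _ (pneg (sval a)) (TN _ (svalP a)).
exists (exist _ pzero T0), (exist _ pone T1), neg, meet, join.
have Teq (a b : {x | T x}) :
    sval a = sval b :> proj R n -> a = b.
  by case: a b => [a ha] [b hb] /= ab; exact: eq_exist.
split=> //.
- by move=> a b h; apply: proj_eq.
- by move=> a b h; apply: proj_eq.
split=> [a b|a b|a b d|a b d|a b|a b|a b d|a|a|a|a];
  apply/Teq/proj_eq; rewrite /= /mx_of_proj /=.
- exact: c.
- by rewrite (c a b : _ *m _ = _ *m _) [X in X - _ = _]addrC.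
- by rewrite mulmxA.
- by rewrite !projUE !subKr mulmxA.
- by rewrite mulmxBr mulmxDr mulmxA projK -addrA subrr addr0.
- by rewrite mulmxA projK -addrA subrr addr0.
- rewrite mulmxBr mulmxDr; congr (_ - _).
  by apply: mulmxIl; [exact: projK|exact: c].
- by rewrite mulmx1.
- by rewrite addr0 mulmx0 subr0.
- by rewrite mulmxBr mulmx1 projK subrr.
- by rewrite mulmxBr mulmx1 projK subrr subr0 addrC subrK.
Qed.

Definition Proj (R : realType) (n : nat) : pba :=
  @PBA (proj_data R n) (fun p => erefl) (fun p q pq => esym pq)
    (@proj_boolean R n).

(* Joins of families are joins of subsets; loc_supI is the frame law, with the
   binary meet of x and y written as the infimum of [set x; y]. *)
Record locale := Locale {
  loc_car :> Type;
  loc_le : loc_car -> loc_car -> Prop;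
  loc_sup : set loc_car -> loc_car;
  loc_inf : set loc_car -> loc_car;
  loc_refl : forall x, loc_le x x;
  loc_trans : forall x y z, loc_le x y -> loc_le y z -> loc_le x z;
  loc_anti : forall x y, loc_le x y -> loc_le y x -> x = y;
  loc_supP : forall S x, loc_le (loc_sup S) x <-> (forall y, S y -> loc_le y x);
  loc_infP : forall S x, loc_le x (loc_inf S) <-> (forall y, S y -> loc_le x y);
  loc_supI : forall x S,
    loc_sup [set loc_inf [set x; y] | y in S] = loc_inf [set x; loc_sup S] }.

Definition loc_top (L : locale) : L := loc_inf set0.
Definition loc_meet (L : locale) (x y : L) : L := loc_inf [set x; y].

(* A morphism K -> L in Loc is a function L -> K. *)
Record loc_hom (K L : locale) := LocHom {
  loc_fun :> L -> K;
  loc_fun_top : loc_fun (@loc_top L) = @loc_top K;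
  loc_fun_meet : forall x y,
    loc_fun (loc_meet x y) = loc_meet (loc_fun x) (loc_fun y);
  loc_fun_sup : forall S, loc_fun (loc_sup S) = loc_sup (loc_fun @` S) }.

Lemma loc_hom_eq (K L : locale) (f g : loc_hom K L) : f =1 g -> f = g.
Proof.
case: f g => [f ft fm fs] [g gt gm gs] /= /funext fg.
by subst g; congr LocHom; exact: Prop_irrelevance.
Qed.

Definition loc_id (K : locale) : loc_hom K K.
Proof. by refine (@LocHom K K id erefl _ _) => // S; rewrite image_id. Defined.

Definition loc_comp (K L M : locale) (g : loc_hom L M) (f : loc_hom K L) :
  loc_hom K M.
Proof.
refine (@LocHom K M (fun x => f (g x)) _ _ _).
- by rewrite !loc_fun_top.
- by move=> x y; rewrite !loc_fun_meet.
- by move=> S; rewrite !loc_fun_sup image_comp.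
Defined.

Definition Loc : category.
Proof.
refine (@Category locale loc_hom loc_id loc_comp _ _ _) => *; exact: loc_hom_eq.
Defined.

Section Opens.
Context (T : topologicalType).

Definition open_set : Type := {U : set T | open U}.

Implicit Types (U V : open_set) (S : set open_set).

Definition open_le U V : Prop := sval U `<=` sval V.

Lemma open_bigcup S : open (\bigcup_(U in S) sval U).
Proof. by apply: bigcup_open => U _; exact: (svalP U). Qed.

Definition open_sup S : open_set := exist _ _ (open_bigcup S).

Definition open_inf S : open_set :=
  exist _ _ (@open_interior T (\bigcap_(U in S) sval U)).

Lemma open_le_anti U V : open_le U V -> open_le V U -> U = V.
Proof.
by case: U V => [U oU] [V oV] UV VU; apply/eq_exist/seteqP.
Qed.

Lemma open_supP S U : open_le (open_sup S) U <-> forall V, S V -> open_le V U.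
Proof.
split=> [SU V SV x Vx|SU x [V SV]]; last exact: SU.
by apply: SU; exists V.
Qed.

Lemma open_infP S U : open_le U (open_inf S) <-> forall V, S V -> open_le U V.
Proof.
split=> [US V SV x /US /interior_subset|US]; first exact.
rewrite /open_le /= -(iffLR (interior_id (sval U)) (svalP U)).
by apply: interiorS => x Ux V SV; exact: US.
Qed.

Lemma open_supI U S :
  open_sup [set open_inf [set U; V] | V in S] = open_inf [set U; open_sup S].
Proof.
have meetE V W : sval (open_inf [set V; W]) = sval V `&` sval W.
  rewrite /= bigcap_setU !bigcap_set1; apply: (iffLR (interior_id _)).
  by apply: openI; [exact: (svalP V)|exact: (svalP W)].
apply: open_le_anti; rewrite /open_le meetE.
  move=> x [_ [V SV <-]]; rewrite meetE => -[Ux Vx].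
  by split=> //; exists V.
move=> x [Ux [V SV Vx]]; exists (open_inf [set U; V]); first by exists V.
by rewrite meetE.
Qed.

Definition opens : locale :=
  @Locale open_set open_le open_sup open_inf
    (fun U => @subset_refl _ _) (fun U V W => @subset_trans _ _ _ _)
    open_le_anti open_supP open_infP open_supI.

End Opens.

(* The empty topological space. *)
HB.instance Definition _ := hasNbhs.Build void principal_filter.
HB.instance Definition _ := Discrete_ofNbhs.Build void erefl.

Record is_ideal (B : boolean_algebra) (I : set B) : Prop := IsIdeal {
  ideal0 : I pzero;
  idealU : forall a b, I a -> I b -> I (bor a b);
  ideal_down : forall a b, ble a b -> I b -> I a }.

Definition ideal (B : boolean_algebra) : Type := {I : set B | is_ideal I}.

Section BooleanTheory.
Context (B : boolean_algebra).
Implicit Types a b c : B.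

Lemma bandC a b : band a b = band b a.
Proof. exact: (ba_meetC (boolean_algebraP B)). Qed.

Lemma bandA a b c : band a (band b c) = band (band a b) c.
Proof. exact: (ba_meetA (boolean_algebraP B)). Qed.

Lemma bandU a b c : band a (bor b c) = bor (band a b) (band a c).
Proof. exact: (ba_meetU (boolean_algebraP B)). Qed.

Lemma bandK a b : band a (bor a b) = a.
Proof. exact: (ba_meetK (boolean_algebraP B)). Qed.

Lemma borK a b : bor a (band a b) = a.
Proof. exact: (ba_joinK (boolean_algebraP B)). Qed.

Lemma band1 a : band a pone = a.
Proof. exact: (ba_meet1 (boolean_algebraP B)). Qed.

Lemma bor0 a : bor a pzero = a.
Proof. exact: (ba_join0 (boolean_algebraP B)). Qed.

Lemma borC a b : bor a b = bor b a.
Proof. exact: (ba_joinC (boolean_algebraP B)). Qed.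

Lemma bandxx a : band a a = a.
Proof. by rewrite -{2}(bor0 a) bandK. Qed.

Lemma band0 a : band a pzero = pzero.
Proof. by rewrite bandC -(bor0 a) borC bandK. Qed.

Lemma ble_refl a : ble a a. Proof. exact: bandxx. Qed.

Lemma ble_trans b a c : ble a b -> ble b c -> ble a c.
Proof. by rewrite /ble => ab bc; rewrite -ab -bandA bc. Qed.

Lemma ble_andl a b : ble (band a b) a.
Proof. by rewrite /ble bandC bandA bandxx. Qed.

Lemma ble_andr a b : ble (band a b) b.
Proof. by rewrite bandC; exact: ble_andl. Qed.

Lemma ble_and c a b : ble c a -> ble c b -> ble c (band a b).
Proof. by rewrite /ble bandA => -> ->. Qed.

Lemma ble_and2 a b c : ble b c -> ble (band a b) (band a c).
Proof.
move=> bc; apply: ble_and; first exact: ble_andl.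
exact: ble_trans (ble_andr _ _) bc.
Qed.

Lemma ble_orl a b : ble a (bor a b). Proof. exact: bandK. Qed.

Lemma ble_orr a b : ble b (bor a b).
Proof. by rewrite borC; exact: ble_orl. Qed.

Lemma ble_or a b c : ble a c -> ble b c -> ble (bor a b) c.
Proof. by rewrite /ble => ac bc; rewrite bandC bandU !(bandC c) ac bc. Qed.

Lemma ble1 a : ble a pone. Proof. exact: band1. Qed.

Lemma ble0 a : ble pzero a. Proof. by rewrite /ble bandC band0. Qed.

End BooleanTheory.

Section HomTheory.
Context (A B : boolean_algebra) (f : pba_hom A B).

Lemma bhomI (a b : A) : f (band a b) = band (f a) (f b).
Proof. by rewrite /band pba_funI; exact: pandE. Qed.

Lemma bhomU (a b : A) : f (bor a b) = bor (f a) (f b).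
Proof. by rewrite /bor pba_funU; exact: porE. Qed.

Lemma bhom_le (a b : A) : ble a b -> ble (f a) (f b).
Proof. by rewrite /ble -bhomI => ->. Qed.

End HomTheory.

Section Idl.
Context (B : boolean_algebra).
Implicit Types (I J : ideal B) (F : set (ideal B)).

Definition ideal_le I J : Prop := sval I `<=` sval J.

Definition ideal_inf_set F : set B := \bigcap_(I in F) sval I.

Lemma is_ideal_inf F : is_ideal (ideal_inf_set F).
Proof.
split.
- by move=> I _; exact: ideal0 (svalP I).
- by move=> a b Fa Fb I FI; apply: (idealU (svalP I)); [exact: Fa|exact: Fb].
- by move=> a b ab Fb I FI; apply: (ideal_down (svalP I) ab); exact: Fb.
Qed.

Definition ideal_inf F : ideal B := exist _ _ (is_ideal_inf F).

(* The ideal generated by the union of F. *)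
Definition ideal_sup F : ideal B :=
  ideal_inf [set J | forall I, F I -> ideal_le I J].

Lemma ideal_le_anti I J : ideal_le I J -> ideal_le J I -> I = J.
Proof. by case: I J => [I hI] [J hJ] IJ JI; apply/eq_exist/seteqP. Qed.

Lemma ideal_infP F I : ideal_le I (ideal_inf F) <-> forall J, F J -> ideal_le I J.
Proof.
split=> [IF J FJ x /IF|IF x Ix J FJ]; [exact|exact: IF].
Qed.

Lemma ideal_supP F I : ideal_le (ideal_sup F) I <-> forall J, F J -> ideal_le J I.
Proof.
split=> [FI J FJ x Jx|FI x supFx]; last exact: supFx.
by apply: FI => K KF; exact: (KF J).
Qed.

Lemma ideal_supI I F :
  ideal_sup [set ideal_inf [set I; J] | J in F] = ideal_inf [set I; ideal_sup F].
Proof.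
set G := (X in ideal_sup X).
apply: ideal_le_anti.
  apply/ideal_supP => _ [J FJ <-] x IJx; have Jx := IJx J (or_intror erefl).
  move=> K [|] ->; first exact: IJx I (or_introl erefl).
  by move=> M MF; exact: (MF J).
move=> x IFx.
have Ix : sval I x by apply: IFx; left.
have Fx : sval (ideal_sup F) x by apply: IFx; right.
pose K : set B := fun y => sval (ideal_sup G) (band x y).
have hK : is_ideal K.
  have [h0 hU hd] := svalP (ideal_sup G).
  split; rewrite /K.
  - by rewrite band0.
  - by move=> a b; rewrite bandU; exact: hU.
  - by move=> a b ab; apply: hd; exact: ble_and2.
rewrite -(bandxx x); apply: (Fx (exist _ K hK)) => J FJ y Jy M; apply.
  by exists J.
move=> N [|] ->; first exact: (ideal_down (svalP I) (ble_andl _ _) Ix).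
exact: (ideal_down (svalP J) (ble_andr _ _) Jy).
Qed.

Definition Idl : locale :=
  @Locale (ideal B) ideal_le ideal_sup ideal_inf
    (fun I => @subset_refl _ _) (fun I J K => @subset_trans _ _ _ _)
    ideal_le_anti ideal_supP ideal_infP ideal_supI.

End Idl.

Section IdlMap.
Context (A B : boolean_algebra) (f : pba_hom A B).

(* The down closure of the image of I under f. *)
Definition Idl_map_set (I : ideal A) : set B :=
  [set b | exists2 a, sval I a & ble b (f a)].

Lemma is_ideal_map (I : ideal A) : is_ideal (Idl_map_set I).
Proof.
have [h0 hU hd] := svalP I; split.
- by exists pzero => //; exact: ble0.
- move=> a b [c Ic ac] [d Id bd]; exists (bor c d); first exact: hU.
  rewrite bhomU; apply: ble_or; [apply: ble_trans ac _|apply: ble_trans bd _].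
    exact: ble_orl.
  exact: ble_orr.
- by move=> a b ab [c Ic bc]; exists c => //; exact: ble_trans bc.
Qed.

Definition Idl_fun (I : Idl A) : Idl B := exist _ _ (is_ideal_map I).

Lemma Idl_fun_top : Idl_fun (loc_top (Idl A)) = loc_top (Idl B).
Proof.
apply: ideal_le_anti => b _; first by move=> I.
by exists pone; [move=> I|rewrite pba_fun1; exact: ble1].
Qed.

Lemma Idl_fun_meet (I J : Idl A) :
  Idl_fun (loc_meet I J) = loc_meet (Idl_fun I) (Idl_fun J).
Proof.
apply: ideal_le_anti => b.
  move=> [a IJa ba] K [|] ->; exists a => //.
    by apply: (IJa I); left.
  by apply: (IJa J); right.
move=> IJb; have [a Ia ba] := IJb _ (or_introl erefl).
have [c Jc bc] := IJb _ (or_intror erefl).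
exists (band a c); last by rewrite bhomI; exact: ble_and.
move=> K [|] ->; first exact: (ideal_down (svalP I) (ble_andl _ _) Ia).
exact: (ideal_down (svalP J) (ble_andr _ _) Jc).
Qed.

Lemma Idl_fun_sup (F : set (Idl A)) :
  Idl_fun (loc_sup F) = loc_sup (Idl_fun @` F).
Proof.
apply: ideal_le_anti.
  move=> b [a Fa ba]; pose G : ideal B := ideal_sup (Idl_fun @` F).
  have [h0 hU hd] := svalP G; apply: (hd _ _ ba).
  have hK : is_ideal [set c : A | sval G (f c)].
    split => /=; first by rewrite pba_fun0.
      by move=> c d; rewrite bhomU; exact: hU.
    by move=> c d /(bhom_le f); exact: hd.
  apply: (Fa (exist _ _ hK)) => I FI c Ic K KF.
  by apply: (KF (Idl_fun I)); [exists I|exists c => //; exact: ble_refl].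
apply/ideal_supP => _ [I FI <-] b [a Ia ba]; exists a => // K KF.
exact: (KF I).
Qed.

Definition Idl_map : loc_hom (Idl B) (Idl A) :=
  LocHom Idl_fun_top Idl_fun_meet Idl_fun_sup.

End IdlMap.

Definition Stone : functor (opposite Boolean) Loc.
Proof.
refine (@Functor (opposite Boolean) Loc Idl (fun A B f => Idl_map f) _ _).
- move=> A; apply: loc_hom_eq => I; apply: ideal_le_anti => a.
    by case=> b Ib ab; exact: (ideal_down (svalP I) ab Ib).
  by move=> Ia; exists a => //; exact: ble_refl.
- move=> X Y Z g f; apply: loc_hom_eq => I; apply: ideal_le_anti => a.
    move=> [c Ic ac]; exists (pba_fun g c) => //.
    by exists c => //; exact: ble_refl.
  move=> [b [c Ic bc] ab]; exists c => //.
  exact: ble_trans ab (bhom_le f bc).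
Defined.

(* Main.v *)
Require Import Defs.
From mathcomp Require Import all_boot all_order all_algebra perm ring.
From mathcomp Require Import sesquilinear spectral complex.
From mathcomp Require Import boolp classical_sets reals topology.

(** The proof is a point-free version of the Kochen-Specker argument.

    Let B be a partial Boolean algebra.  Each Boolean subalgebra T of B includes
    into B; applying F and the isomorphism of F T with the Stone spectrum of T
    turns this inclusion into a frame homomorphism from Idl T to F B, and by
    naturality these homomorphisms agree on smaller subalgebras.  Evaluating
    them on principal ideals attaches to each a in B an element v a of the
    frame F B, so that v sends 0, 1 and the meets and joins of commeasurable
    elements to those of F B ([spectrum_open_valuation]).  If F B were the
    two-element frame, v would be a two-valued valuation of B, which
    Kochen and Specker exclude for projections in dimension at least 3.

    The frame F B need not have points, but only finitely many rays are needed
    for their argument, and it goes through with truth values in any frame.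
    Moreover the configuration used here needs no case distinction: with
    w := v (ray (0, 0, 1)), one derives by propagation alone a list of rays x
    with w <= v x and of rays y with w and v y disjoint, until both hold for the
    same ray ([kochen_specker_axis]).  Hence w is the bottom element.  The only
    principles used are that orthogonal rays have disjoint values and that, if
    w is disjoint from the values of two members of an orthogonal basis, then
    it lies below the value of the third.

    A ray of 3-space is carried to dimension n by an isometry, which can be
    chosen to map (0, 0, 1) to any standard basis vector, so v vanishes on the
    projection onto each standard basis vector ([valuation_axis]).  These
    projections sum to 1, so the top and the bottom of the frame coincide
    ([valuation_trivial]), and a frame in which they coincide is initial as a
    locale. *)

Set Implicit Arguments.
Unset Strict Implicit.
Unset Printing Implicit Defensive.

Import GRing.Theory Num.Theory.
Local Open Scope classical_set_scope.
Local Open Scope ring_scope.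
Local Open Scope sesquilinear_scope.

(** * Finite meets and joins in a locale *)

Section LocaleTheory.
Context (L : locale).
Implicit Types (x y z w : L).

Definition loc_bot : L := loc_sup set0.
Definition loc_join x y : L := loc_sup [set x; y].
Definition loc_disjoint x y := loc_le (loc_meet x y) loc_bot.

Lemma loc_bot_le x : loc_le loc_bot x.
Proof. by apply/loc_supP. Qed.

Lemma loc_le_bot x : loc_le x loc_bot -> x = loc_bot.
Proof. by move=> xb; apply: loc_anti => //; exact: loc_bot_le. Qed.

Lemma loc_top_le x : loc_le x (loc_top L).
Proof. by apply/loc_infP. Qed.

Lemma loc_meet_le x y z : loc_le z (loc_meet x y) <-> loc_le z x /\ loc_le z y.
Proof.
split=> [/loc_infP h|[zx zy]]; last by apply/loc_infP => _ [] ->.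
by split; apply: h; [left|right].
Qed.

Lemma loc_join_le x y z : loc_le (loc_join x y) z <-> loc_le x z /\ loc_le y z.
Proof.
split=> [/loc_supP h|[xz yz]]; last by apply/loc_supP => _ [] ->.
by split; apply: h; [left|right].
Qed.

Lemma loc_meet_leL x y : loc_le (loc_meet x y) x.
Proof. by have /loc_meet_le[] := loc_refl (loc_meet x y). Qed.

Lemma loc_meet_leR x y : loc_le (loc_meet x y) y.
Proof. by have /loc_meet_le[] := loc_refl (loc_meet x y). Qed.

Lemma loc_disjoint_le w x y :
  loc_disjoint x y -> loc_le w x -> loc_disjoint w y.
Proof.
move=> + wx; apply: loc_trans; apply/loc_meet_le; split.
  by apply: loc_trans wx; exact: loc_meet_leL.
exact: loc_meet_leR.
Qed.

Lemma loc_disjoint_le_bot w x :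
  loc_disjoint w x -> loc_le w x -> loc_le w loc_bot.
Proof.
move=> + wx; apply: loc_trans; apply/loc_meet_le.
by split=> //; exact: loc_refl.
Qed.

(** Disjunctive syllogism: this is where the frame law enters. *)
Lemma loc_disjoint_join_le w y z :
  loc_le w (loc_join y z) -> loc_disjoint w y -> loc_le w z.
Proof.
move=> wyz wy; have : loc_le w (loc_meet w (loc_join y z)).
  by apply/loc_meet_le; split=> //; exact: loc_refl.
rewrite /loc_meet -loc_supI => /loc_trans; apply; apply/loc_supP => _ [a + <-].
case=> ->; last exact: loc_meet_leR.
by apply: loc_trans wy _; exact: loc_bot_le.
Qed.

End LocaleTheory.

Section LocHomTheory.
Context (K L : locale) (f : loc_hom K L).

Lemma loc_fun_bot : f (loc_bot L) = loc_bot K.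
Proof. by rewrite /loc_bot loc_fun_sup image_set0. Qed.

Lemma loc_fun_join x y : f (loc_join x y) = loc_join (f x) (f y).
Proof. by rewrite /loc_join loc_fun_sup image_setU !image_set1. Qed.

End LocHomTheory.

(** * Locales whose top and bottom coincide *)

Section TrivialLocale.
Context (L : locale) (L_trivial : loc_le (loc_top L) (loc_bot L)).

Lemma trivial_locale_eq (x y : L) : x = y.
Proof.
have bot z : z = loc_bot L.
  by apply: loc_le_bot; apply: loc_trans L_trivial; exact: loc_top_le.
by rewrite (bot x) (bot y).
Qed.

Lemma trivial_locale_initial : @is_initial Loc L.
Proof.
move=> K; unshelve eexists (LocHom (loc_fun := fun=> loc_bot L) _ _ _);
  try by move=> *; exact: trivial_locale_eq.
by split=> // g _; apply: loc_hom_eq => x; exact: trivial_locale_eq.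
Qed.

End TrivialLocale.

Lemma initial_isomorphic (C : category) (X Y : C) :
  is_initial X -> is_initial Y -> isomorphic X Y.
Proof.
move=> iX iY; have [f _] := iX Y; have [g _] := iY X; exists f, g.
have [i [_ iU]] := iX X; have [j [_ jU]] := iY Y.
by split; [rewrite -(iU (cat_comp g f)) // -(iU (cat_id X))
          |rewrite -(jU (cat_comp f g)) // -(jU (cat_id Y))].
Qed.

Lemma opens_void_trivial :
  loc_le (loc_top (opens void)) (loc_bot (opens void)).
Proof. by case. Qed.

(** * Boolean subalgebras of a partial Boolean algebra *)

Section Subalgebra.
Context (B : pba).
Implicit Types (T : set B) (a b : B).

Record is_subalgebra T : Prop := IsSubalgebra {
  sub_com : pairwise_com T;
  sub0 : T pzero;
  sub1 : T pone;
  subN : forall a, T a -> T (pneg a);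
  subI : forall a b (h : pcom a b), T a -> T b -> T (pand a b h);
  subU : forall a b (h : pcom a b), T a -> T b -> T (por a b h) }.

Lemma boolean_on_subalgebra T :
  pairwise_com T -> boolean_on T -> is_subalgebra T.
Proof.
move=> Tcom [z [o [neg [meet [join [[z0 o1] negE meetE joinE _]]]]]].
split=> //.
- by rewrite -z0; exact: svalP.
- by rewrite -o1; exact: svalP.
- by move=> a Ta; rewrite -(negE (exist _ a Ta)); exact: svalP.
- move=> a b h Ta Tb.
  by rewrite -(meetE (exist _ a Ta) (exist _ b Tb) h); exact: svalP.
- move=> a b h Ta Tb.
  by rewrite -(joinE (exist _ a Ta) (exist _ b Tb) h); exact: svalP.
Qed.

Lemma subalgebra_exists (S : set B) :
  pairwise_com S -> exists2 T, S `<=` T & is_subalgebra T.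
Proof.
move=> /pba_boolean [T [ST Tcom Tbool]].
by exists T => //; exact: boolean_on_subalgebra.
Qed.

End Subalgebra.

(** Boolean identities are inherited along injective homomorphisms.  This serves
    for a subalgebra T, which is contained in a set on which the operations are
    known to satisfy these identities. *)
Lemma is_boolean_algebra_inj (X Y : Type) (f : X -> Y)
    (x0 x1 : X) (xN : X -> X) (xI xU : X -> X -> X)
    (y0 y1 : Y) (yN : Y -> Y) (yI yU : Y -> Y -> Y) :
  injective f -> f x0 = y0 -> f x1 = y1 -> {morph f : a / xN a >-> yN a} ->
  {morph f : a b / xI a b >-> yI a b} -> {morph f : a b / xU a b >-> yU a b} ->
  is_boolean_algebra y0 y1 yN yI yU -> is_boolean_algebra x0 x1 xN xI xU.
Proof.
move=> fI f0 f1 fN fM fU [mC jC mA jA mK jK mU m1 j0 mN jN].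
split=> [a b|a b|a b c|a b c|a b|a b|a b c|a|a|a|a]; apply: fI;
  rewrite ?(fM, fU, fN, f0, f1); auto.
Qed.

Section SubBoolean.
Context (B : pba) (T : set B) (hT : is_subalgebra T).

Definition sub_data : pba_data :=
  @PBAData {x : B | T x} (fun a b => pcom (sval a) (sval b))
    (exist _ pzero (sub0 hT)) (exist _ pone (sub1 hT))
    (fun a => exist _ (pneg (sval a)) (subN hT (svalP a)))
    (fun a b h => exist _ (pand (sval a) (sval b) h)
                    (subI hT h (svalP a) (svalP b)))
    (fun a b h => exist _ (por (sval a) (sval b) h)
                    (subU hT h (svalP a) (svalP b))).

Lemma sub_total (a b : sub_data) : pcom a b.
Proof. exact: (sub_com hT (svalP a) (svalP b)). Qed.

Lemma sub_boolean (S : set sub_data) : pairwise_com S ->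
  exists T' : set sub_data, [/\ S `<=` T', pairwise_com T' & boolean_on T'].
Proof.
move=> _; exists setT; split=> // [a b _ _|]; first exact: sub_total.
have [T' [TT' _]] := pba_boolean (sub_com hT).
move=> [z [o [neg [meet [join [[z0 o1] negE meetE joinE ba]]]]]].
pose i (a : sub_data) : {x : sub_data | setT x} := exist _ a I.
exists (i pzero), (i pone), (fun a => i (pneg (sval a))),
  (fun a b => i (pand (sval a) (sval b) (sub_total _ _))),
  (fun a b => i (por (sval a) (sval b) (sub_total _ _))).
split=> //.
- by move=> a b h; congr pand; exact: Prop_irrelevance.
- by move=> a b h; congr por; exact: Prop_irrelevance.
pose f (a : {x : sub_data | setT x}) : {x : B | T' x} :=
  exist _ (sval (sval a)) (TT' _ (svalP (sval a))).
have T'eq (x y : {x : B | T' x}) : sval x = sval y -> x = y.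
  by case: x y => [x ?] [y ?] /= xy; exact: eq_exist.
apply: (@is_boolean_algebra_inj _ _ f) ba => //=.
- move=> [[a Ta] aT] [[b Tb] bT] /(congr1 sval) /= ab.
  by apply: eq_exist; exact: eq_exist.
- by apply: T'eq.
- by apply: T'eq.
- by move=> a; apply: T'eq; rewrite negE.
- by move=> a b; apply: T'eq; rewrite /= (meetE (f a) (f b) (sub_total _ _)).
- by move=> a b; apply: T'eq; rewrite /= (joinE (f a) (f b) (sub_total _ _)).
Qed.

Definition sub_pba : pba :=
  @PBA sub_data (fun a => pcom_refl (sval a))
    (fun a b h => pcom_sym h) sub_boolean.

Definition sub_algebra : boolean_algebra := @BooleanAlgebra sub_pba sub_total.

Definition sub_incl : pba_hom sub_algebra B :=
  @PBAHom sub_algebra B sval (fun a b h => h) erefl erefl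
    (fun a b h => erefl) (fun a b h => erefl) (fun a => erefl).

End SubBoolean.

Section SubIncl.
Context (B : pba) (S T : set B).
Context (hS : is_subalgebra S) (hT : is_subalgebra T) (ST : S `<=` T).

Definition sub_widen : pba_hom (sub_algebra hS) (sub_algebra hT).
Proof.
pose f (a : sub_algebra hS) : sub_algebra hT :=
  exist _ (sval a) (ST (svalP a)).
by refine (@PBAHom _ (sub_algebra hT) f (fun a b h => h) _ _ _ _ _) => *;
  apply: eq_exist.
Defined.

Lemma sub_widen_incl : pba_comp (sub_incl hT) sub_widen = sub_incl hS.
Proof. exact: pba_hom_eq. Qed.

End SubIncl.

Lemma pcom_sub_algebra (B : pba) (a b : B) : pcom a b ->
  exists (T : set B) (hT : is_subalgebra T) (a' b' : sub_algebra hT),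
    a = sval a' /\ b = sval b'.
Proof.
move=> ab; have [|T abT hT] := @subalgebra_exists B [set a; b].
  by move=> _ _ [] -> [] -> //;
    [exact: pcom_refl|exact: pcom_sym|exact: pcom_refl].
by exists T, hT, (exist _ a (abT _ (or_introl erefl))),
  (exist _ b (abT _ (or_intror erefl))).
Qed.

Section Generated.
Context (B : pba) (a : B).

(** Among the Boolean subalgebras that contain a there is a smallest one, so the
    value of a can be defined there and compared with all the others along
    inclusions. *)
Definition generated : set B :=
  [set x | forall T, is_subalgebra T -> T a -> T x].

Lemma generated_sub : is_subalgebra generated.
Proof.
have [|T0 aT0 hT0] := @subalgebra_exists B [set a].
  by move=> _ _ -> ->; exact: pcom_refl.
split.
- by move=> x y gx gy; apply: (sub_com hT0); [apply: gx|apply: gy] => //;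
    exact: aT0.
- by move=> T hT _; exact: sub0.
- by move=> T hT _; exact: sub1.
- by move=> x gx T hT Ta; apply: (subN hT); exact: gx.
- by move=> x y h gx gy T hT Ta; apply: (subI hT); [exact: gx|exact: gy].
- by move=> x y h gx gy T hT Ta; apply: (subU hT); [exact: gx|exact: gy].
Qed.

Lemma mem_generated : generated a. Proof. by move=> T. Qed.

Lemma generated_min T : is_subalgebra T -> T a -> generated `<=` T.
Proof. by move=> hT Ta x; exact. Qed.

End Generated.

(** * Principal ideals *)

Section Principal.
Context (A : boolean_algebra).
Implicit Types a b : A.

Lemma is_ideal_principal a : is_ideal [set b | ble b a].
Proof.
split=> [|b c|b c]; [exact: ble0|exact: ble_or|exact: ble_trans].
Qed.

Definition principal a : Idl A := exist _ _ (is_ideal_principal a).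

Lemma principal_le a (J : Idl A) : loc_le (principal a) J <-> sval J a.
Proof.
split=> [|Ja b /= ba]; first by apply; exact: ble_refl.
exact: (ideal_down (svalP J) ba Ja).
Qed.

Lemma principal1 : principal pone = loc_top (Idl A).
Proof. by apply: loc_anti; [exact: loc_top_le|move=> b _; exact: ble1]. Qed.

Lemma principal0 : principal pzero = loc_bot (Idl A).
Proof.
apply: loc_anti; last exact: loc_bot_le.
by apply/principal_le; exact: (ideal0 (svalP (_ : ideal A))).
Qed.

Lemma principalI a b :
  principal (band a b) = loc_meet (principal a) (principal b).
Proof.
apply: loc_anti.
  by apply/loc_meet_le; split=> c ca; apply: ble_trans ca _;
    [exact: ble_andl|exact: ble_andr].
move=> c ab; apply: ble_and; first by apply: (ab (principal a)); left.
by apply: (ab (principal b)); right.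
Qed.

Lemma principalU a b :
  principal (bor a b) = loc_join (principal a) (principal b).
Proof.
apply: loc_anti; last first.
  by apply/loc_join_le; split=> c ca; apply: ble_trans ca _;
    [exact: ble_orl|exact: ble_orr].
have /loc_join_le[/principal_le aJ /principal_le bJ] :=
  loc_refl (loc_join (principal a) (principal b)).
by apply/principal_le; exact: (idealU (svalP (_ : ideal A)) aJ bJ).
Qed.

End Principal.

Lemma Idl_fun_principal (A A' : boolean_algebra) (f : pba_hom A A') (a : A) :
  Idl_fun f (principal a) = principal (f a).
Proof.
apply: loc_anti; last by apply/principal_le; exists a; exact: ble_refl.
by move=> b [c /= ca bc]; exact: ble_trans bc (bhom_le f ca).
Qed.

(** * The valuation of a partial Boolean algebra in its spectrum *)

Record is_valuation (B : pba) (L : locale) (v : B -> L) : Prop := IsValuation {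
  valuation0 : v pzero = loc_bot L;
  valuation1 : v pone = loc_top L;
  valuationI : forall a b (h : pcom a b), v (pand a b h) = loc_meet (v a) (v b);
  valuationU : forall a b (h : pcom a b), v (por a b h) = loc_join (v a) (v b) }.

Section Valuation.
Context (F : functor (opposite PBoolean) Loc).
Context (eta : forall X : opposite Boolean,
  Defs.hom (functor_comp F (functor_op Boolean_incl) X) (Stone X)).
Context (eta_natural : forall (X Y : opposite Boolean) (f : Defs.hom X Y),
  cat_comp (eta Y) (Defs.fmap (functor_comp F (functor_op Boolean_incl)) f) =
  cat_comp (Defs.fmap Stone f) (eta X)).
Context (B : pba).

Definition spectrum_map (T : set B) (hT : is_subalgebra T) :
    loc_hom (F B) (Idl (sub_algebra hT)) :=
  loc_comp (eta (sub_algebra hT) : loc_hom _ _)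
    (@Defs.fmap _ _ F (B : opposite PBoolean) (sub_pba hT) (sub_incl hT)).

Definition spectrum_open (a : B) : (F B : locale) :=
  spectrum_map (generated_sub a)
    (@principal (sub_algebra (generated_sub a))
      (exist _ a (@mem_generated B a))).

(** By naturality with respect to the inclusion of the subalgebra generated by
    a, the value at a can be computed in any subalgebra containing a, and so in
    one that also contains a given element commeasurable with a. *)
Lemma spectrum_openE (T : set B) (hT : is_subalgebra T) (a : sub_algebra hT) :
  spectrum_open (sval a) = spectrum_map hT (principal a).
Proof.
set gen := generated_sub (sval a).
pose j := sub_widen gen hT (generated_min hT (svalP a)).
have natj := eta_natural (j : @Defs.hom (opposite Boolean) (sub_algebra hT)
  (sub_algebra gen)).
rewrite /spectrum_open /spectrum_map /= -/gen.
have -> : sub_incl gen = pba_comp (sub_incl hT) j by rewrite sub_widen_incl.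
rewrite (@Defs.fmap_comp _ _ F (B : opposite PBoolean) (sub_pba hT)
  (sub_pba gen) j (sub_incl hT)) /=.
have /= -> := congr1 (fun f : loc_hom _ _ => f (@principal (sub_algebra gen)
  (exist _ (sval a) (@mem_generated B (sval a))))) natj.
rewrite Idl_fun_principal.
apply: (congr1 (fun x => spectrum_map hT (principal x))).
by case: a @gen @j natj => a Ta gen j natj; exact: eq_exist.
Qed.

Lemma spectrum_open_valuation : is_valuation spectrum_open.
Proof.
have [|T0 _ hT0] := @subalgebra_exists B set0; first by move=> ? ? [].
split.
- by rewrite (spectrum_openE (pzero : sub_algebra hT0)) principal0 loc_fun_bot.
- by rewrite (spectrum_openE (pone : sub_algebra hT0)) principal1 loc_fun_top.
- move=> a b h; have [T [hT [a' [b' [aE bE]]]]] := pcom_sub_algebra h.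
  subst a b; rewrite !spectrum_openE -loc_fun_meet -principalI -spectrum_openE.
  by congr spectrum_open; exact: pandE.
- move=> a b h; have [T [hT [a' [b' [aE bE]]]]] := pcom_sub_algebra h.
  subst a b; rewrite !spectrum_openE -loc_fun_join -principalU -spectrum_openE.
  by congr spectrum_open; exact: porE.
Qed.

End Valuation.

(** * The Kochen-Specker argument in a locale *)

Definition vec3 : Type := int * int * int.

Definition dot (a b : vec3) : int :=
  let: (a1, a2, a3) := a in let: (b1, b2, b3) := b in
  a1 * b1 + a2 * b2 + a3 * b3.

Definition cross (a b : vec3) : vec3 :=
  let: (a1, a2, a3) := a in let: (b1, b2, b3) := b in
  (a2 * b3 - a3 * b2, a3 * b1 - a1 * b3, a1 * b2 - a2 * b1).

Definition orthobasis (a b c : vec3) : bool :=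
  [&& dot a b == 0, dot a c == 0, dot b c == 0,
      dot a a != 0, dot b b != 0 & dot c c != 0].

Lemma dot_cross (a b : vec3) : dot a (cross a b) = 0.
Proof. by case: a b => [[a1 a2] a3] [[b1 b2] b3] /=; ring. Qed.

(** The values u a of the nonzero vectors a of integer 3-space stand for the
    truth values of their rays, and t for the truth value of the whole space,
    which is to be decomposed along each orthogonal basis. *)
Section KochenSpecker.
Context (L : locale) (t : L) (u : vec3 -> L).
Context (u_le : forall a, loc_le (u a) t).
Context (u_orth : forall a b, dot a b = 0 -> loc_disjoint (u a) (u b)).
Context (u_basis : forall a b c, orthobasis a b c ->
  loc_le t (loc_join (u a) (loc_join (u b) (u c)))).

Lemma orthobasis_third (w : L) (a b c : vec3) : orthobasis a b c ->
  loc_le w t -> loc_disjoint w (u a) -> loc_disjoint w (u b) -> loc_le w (u c).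
Proof.
move=> abc wt wa wb.
apply: loc_disjoint_join_le wb; apply: loc_disjoint_join_le wa.
exact: loc_trans wt (u_basis abc).
Qed.

(** Clifton's eight rays: if a and b both held then, in the orthogonal basis
    made of a x c, b x c and c, the first two vectors would fail, being
    orthogonal to a and to b, so that c would hold; in the same way d would
    hold, although c and d are orthogonal.  Over the reals suitable c and d
    exist whenever the cosine of the angle of a and b is at most 1/3 in absolute
    value. *)
Lemma clifton_disjoint (c d a b : vec3) :
  orthobasis (cross a c) (cross b c) c ->
  orthobasis (cross a d) (cross b d) d ->
  dot c d = 0 -> loc_disjoint (u a) (u b).
Proof.
move=> hc hd cd; set w := loc_meet (u a) (u b).
have wa : loc_le w (u a) := loc_meet_leL _ _.
have wb : loc_le w (u b) := loc_meet_leR _ _.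
have wt : loc_le w t := loc_trans wa (u_le a).
have excl x y : loc_le w (u x) -> loc_disjoint w (u (cross x y)).
  by apply: loc_disjoint_le; apply/u_orth/dot_cross.
have wc := orthobasis_third hc wt (excl a c wa) (excl b c wb).
have wd := orthobasis_third hd wt (excl a d wa) (excl b d wb).
exact: loc_disjoint_le_bot (loc_disjoint_le (u_orth cd) wc) wd.
Qed.

(** The truth of (0, 0, 1) is transported to vectors that lie in other
    directions: if a member of a basis makes a small enough angle with a true
    vector, the two other members are excluded by [clifton_disjoint] or by
    orthogonality.  Passing through (0, 1, 3) and (0, 2, 3), this reaches
    (3, 1, 5) and its mirror image (-3, 1, 5), which exclude (1, 0, -1) and
    (1, 0, 1) respectively.  Together with (0, 1, 0), which is orthogonal to
    (0, 0, 1), these two form a basis, none of whose members would be true. *)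
Lemma kochen_specker_axis : loc_le (u (0, 0, 1)) (loc_bot L).
Proof.
set w := u (0, 0, 1).
have third a b c (abc : orthobasis a b c) :
    loc_disjoint w (u a) -> loc_disjoint w (u b) -> loc_le w (u c).
  exact: orthobasis_third (u_le _).
have orth a b (ab : dot a b = 0) : loc_le w (u a) -> loc_disjoint w (u b).
  exact/loc_disjoint_le/u_orth.
have clifton c d a b (hc : orthobasis (cross a c) (cross b c) c)
    (hd : orthobasis (cross a d) (cross b d) d) (cd : dot c d = 0) :
    loc_le w (u a) -> loc_disjoint w (u b).
  exact/loc_disjoint_le/(clifton_disjoint hc hd cd).
have w001 : loc_le w (u (0, 0, 1)) := loc_refl _.
have n100 := orth (0, 0, 1) (1, 0, 0) erefl w001.
have n010 := orth (0, 0, 1) (0, 1, 0) erefl w001.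
(* The two vectors given to clifton are the orthogonal witnesses c and d.  The
   bases are chosen to make them integral and small. *)
have w013 : loc_le w (u (0, 1, 3)).
  apply: (third (2, 3, -1) (5, -3, 1)) => //.
    exact: (clifton (2, 0, -1) (1, -1, 2)) w001.
  exact: (clifton (5, 0, 1) (1, 2, -5)) w001.
have w023 : loc_le w (u (0, 2, 3)).
  apply: (third (1, 0, 0) (0, 3, -2)) => //.
  exact: (clifton (1, 0, -1) (1, 0, 1)) w013.
have w315 : loc_le w (u (3, 1, 5)).
  apply: (third (1, -3, 0) (3, 1, -2)) => //; first exact: orth w001.
  exact: (clifton (0, 1, -2) (4, -2, -1)) w023.
have w315' : loc_le w (u (-3, 1, 5)).
  apply: (third (-1, -3, 0) (-3, 1, -2)) => //; first exact: orth w001.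
  exact: (clifton (0, 1, -2) (-4, -2, -1)) w023.
have n101 : loc_disjoint w (u (1, 0, -1)).
  exact: (clifton (0, 1, -1) (1, -1, -1)) w315.
have w101 : loc_le w (u (1, 0, 1)).
  exact: (third (0, 1, 0) (1, 0, -1)).
apply: loc_disjoint_le_bot w101.
exact: (clifton (0, 1, -1) (-1, -1, -1)) w315'.
Qed.

End KochenSpecker.

(** * Projections onto rays *)

Section ValuationProj.
Context (R : realType) (n : nat) (L : locale) (v : Proj R n -> L).
Context (hv : is_valuation v).
Implicit Types p q r : Proj R n.

Local Notation mx := (@mx_of_proj R n).

Lemma proj_adj p : (mx p)^t* = mx p.
Proof. by case: p => p /= /is_projP[]. Qed.

Lemma proj_orth_comm p q : mx p *m mx q = 0 -> proj_com p q.
Proof.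
move=> pq; rewrite /proj_com pq; apply/esym.
by rewrite -(proj_adj p) -(proj_adj q) -map_mxM -trmx_mul pq trmx0 map_mx0.
Qed.

Lemma valuation_orth p q : mx p *m mx q = 0 -> loc_disjoint (v p) (v q).
Proof.
move=> pq; rewrite /loc_disjoint -(valuationI hv (proj_orth_comm pq)).
rewrite -(valuation0 hv).
rewrite (_ : pand _ _ _ = pzero); first exact: loc_refl.
exact: proj_eq.
Qed.

Lemma valuation_le p q : mx p *m mx q = mx p -> loc_le (v p) (v q).
Proof.
move=> pq; have h : proj_com p q.
  by rewrite /proj_com pq -(proj_adj q) -(proj_adj p) -map_mxM -trmx_mul pq.
have <- : pand p q h = p by exact: proj_eq.
by rewrite (valuationI hv); exact: loc_meet_leR.
Qed.

Lemma valuation_add p q r : mx p *m mx q = 0 -> mx r = mx p + mx q ->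
  v r = loc_join (v p) (v q).
Proof.
move=> pq rE; rewrite -(valuationU hv (proj_orth_comm pq)); congr v.
by apply: proj_eq; rewrite rE /= /mx_of_proj /= -/(mx_of_proj _) pq subr0.
Qed.

End ValuationProj.

Section Rays.
Context (R : realType).
Local Notation C := R[i].

Definition row_of_vec (a : vec3) : 'rV[C]_3 :=
  \row_j (nth 0 [:: a.1.1; a.1.2; a.2] j)%:~R.

Lemma row_of_vec_dot a b :
  row_of_vec a *m (row_of_vec b)^T = (dot a b)%:~R%:M.
Proof.
case: a b => [[a1 a2] a3] [[b1 b2] b3]; apply/matrixP=> i j.
rewrite !ord1 !mxE !big_ord_recl big_ord0 !mxE /=.
by rewrite addr0 !rmorphD !rmorphM /= addrA.
Qed.

Lemma row_of_vec_conj a : map_mx Num.Def.conjC (row_of_vec a) = row_of_vec a.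
Proof.
by case: a => [[a1 a2] a3]; apply/matrixP=> i j; rewrite !mxE rmorph_int.
Qed.

(** The orthogonal projection onto the line spanned by a; it is zero if a is,
    since the inverse of zero is zero. *)
Definition line (a : vec3) : 'M[C]_3 :=
  (dot a a)%:~R^-1 *: ((row_of_vec a)^T *m row_of_vec a).

Lemma line_conj a : (line a)^t* = line a.
Proof.
rewrite /line linearZ /= trmx_mul trmxK map_mxZ map_mxM -map_trmx.
by rewrite row_of_vec_conj fmorphV /= rmorph_int.
Qed.

Lemma line_mul a b : line a *m line b =
  (dot a a)%:~R^-1 *: ((dot b b)%:~R^-1 *: ((dot a b)%:~R *:
    ((row_of_vec a)^T *m row_of_vec b))).
Proof.
rewrite /line -scalemxAl -scalemxAr; congr (_ *: (_ *: _)).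
by rewrite -mulmxA [row_of_vec a *m _]mulmxA row_of_vec_dot mul_scalar_mx
  -scalemxAr.
Qed.

Lemma line_idem a : line a *m line a = line a.
Proof.
rewrite line_mul; have [a0|a0] := eqVneq ((dot a a)%:~R : C) 0.
  by rewrite /line a0 invr0 !scale0r.
by congr (_ *: _); rewrite scalerA mulVf // scale1r.
Qed.

Lemma line_orth a b : dot a b = 0 -> line a *m line b = 0.
Proof. by move=> ab; rewrite line_mul ab scale0r !scaler0. Qed.

(** The matrix U with rows a, b and c has the right inverse V whose columns are
    these vectors divided by their squared norms, and the sum of the three
    projections is V U. *)
Lemma line_basis a b c : orthobasis a b c -> line a + (line b + line c) = 1%:M.
Proof.
move=> /and5P[/eqP ab /eqP ac /eqP bc a0 /andP[b0 c0]].
have dotC x y : dot x y = 0 -> dot y x = 0.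
  move=> <-; case: x y => [[x1 x2] x3] [[y1 y2] y3] /=; ring.
have [ba ca cb] := And3 (dotC _ _ ab) (dotC _ _ ac) (dotC _ _ bc).
pose dual x : 'cV[C]_3 := (dot x x)%:~R^-1 *: (row_of_vec x)^T.
have mul_dual0 x y : dot x y = 0 -> row_of_vec x *m dual y = 0.
  by move=> xy; rewrite -scalemxAr row_of_vec_dot xy raddf0 scaler0.
have mul_dual1 x : dot x x != 0 -> row_of_vec x *m dual x = 1%:M.
  move=> x0; rewrite -scalemxAr row_of_vec_dot scale_scalar_mx mulVf //.
  by rewrite intr_eq0.
have lineE x : line x = dual x *m row_of_vec x by rewrite /line scalemxAl.
pose U : 'M[C]_(1 + (1 + 1), 3) :=
  col_mx (row_of_vec a) (col_mx (row_of_vec b) (row_of_vec c)).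
pose V : 'M[C]_(3, 1 + (1 + 1)) :=
  row_mx (dual a) (row_mx (dual b) (dual c)).
have UV : U *m V = 1%:M.
  rewrite !mul_col_row mul_col_mx mul_mx_row !mul_dual1 // !mul_dual0 //.
  by rewrite row_mx0 col_mx0 -!scalar_mx_block.
rewrite !lineE -!mul_row_col; exact: mulmx1C UV.
Qed.

Context (n : nat) (W : 'M[C]_(n, 3)) (hW : W^t* *m W = 1%:M).

Definition dilate (p : 'M[C]_3) : 'M[C]_n := W *m p *m W^t*.

Lemma dilateM p q : dilate p *m dilate q = dilate (p *m q).
Proof.
by rewrite /dilate !mulmxA -[W *m p *m _ *m W]mulmxA hW mulmx1.
Qed.

Lemma dilateD p q : dilate (p + q) = dilate p + dilate q.
Proof. by rewrite /dilate mulmxDr mulmxDl. Qed.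

Lemma dilate0 : dilate 0 = 0.
Proof. by rewrite /dilate mulmx0 mul0mx. Qed.

Lemma dilate_proj p : p^t* = p -> p *m p = p -> is_proj (dilate p).
Proof.
move=> pA pp; apply/is_projP; split; last by rewrite dilateM pp.
by rewrite /dilate !trmx_mul !map_mxM pA map_trmx trmxK -map_mx_comp
  (map_mx_id (@conjCK _)) mulmxA.
Qed.

Definition ray (a : vec3) : Proj R n :=
  exist _ _ (dilate_proj (line_conj a) (line_idem a)).

Lemma dilate1_proj : is_proj (dilate 1%:M).
Proof. by apply: dilate_proj; rewrite ?mulmx1 // trmx1 map_mx1. Qed.

Definition range_proj : Proj R n := exist _ _ dilate1_proj.

Lemma ray_orth a b :
  dot a b = 0 -> mx_of_proj (ray a) *m mx_of_proj (ray b) = 0.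
Proof. by move=> ab; rewrite dilateM line_orth // dilate0. Qed.

Context (L : locale) (v : Proj R n -> L) (hv : is_valuation v).

Lemma ray_bot : loc_le (v (ray (0, 0, 1))) (loc_bot L).
Proof.
apply: (@kochen_specker_axis L (v range_proj) (v \o ray));
  [move=> a|move=> a b ab|move=> a b c abc].
- by apply: (valuation_le hv); rewrite dilateM mulmx1.
- by apply: (valuation_orth hv); exact: ray_orth.
have [ab ac bc] : [/\ dot a b = 0, dot a c = 0 & dot b c = 0].
  by case/and5P: abc => /eqP-> /eqP-> /eqP->.
have [r rE] : exists r : Proj R n, mx_of_proj r = dilate (line b + line c).
  exists (por (ray b) (ray c) (proj_orth_comm (ray_orth bc))).
  by rewrite dilateD -[RHS]subr0 -(ray_orth bc).
rewrite /= -(valuation_add hv (ray_orth bc) (etrans rE (dilateD _ _))).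
have ar : mx_of_proj (ray a) *m mx_of_proj r = 0.
  by rewrite rE dilateM mulmxDr !line_orth // addr0 dilate0.
rewrite -(valuation_add hv ar (r := range_proj)); first exact: loc_refl.
by rewrite rE -dilateD line_basis.
Qed.

End Rays.

(** * Triviality of the locale *)

Section Collapse.
Context (R : realType) (n : nat) (hn : (3 <= n)%N).
Local Notation C := R[i].

Lemma conj_mx01 m p (E : 'I_m -> 'I_p -> bool) :
  map_mx Num.Def.conjC (\matrix_(i, j) (E i j)%:R : 'M[C]_(m, p)) =
  \matrix_(i, j) (E i j)%:R.
Proof. by apply/matrixP=> i j; rewrite !mxE rmorph_nat. Qed.

(** The transposition arranges that the last basis vector of 3-space, which has
    index 2, goes to the i-th basis vector, while the other two go to some
    other basis vectors. *)
Definition basis_frame (i : 'I_n) : 'M[C]_(n, 3) :=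
  \matrix_(a, b) (a == tperm (widen_ord hn ord_max) i (widen_ord hn b))%:R.

Lemma basis_frameP i : (basis_frame i)^t* *m basis_frame i = 1%:M.
Proof.
rewrite -map_trmx conj_mx01; apply/matrixP=> b c; rewrite !mxE.
under eq_bigr do rewrite !mxE -natrM mulnb.
rewrite -natr_sum.
rewrite (bigD1 (tperm (widen_ord hn ord_max) i (widen_ord hn b))) //=.
rewrite eqxx /= big1 ?addn0 => [|a /negbTE -> //].
by rewrite (inj_eq perm_inj).
Qed.

Lemma ray_basis_frame i :
  mx_of_proj (ray (basis_frameP i) (0, 0, 1)) = delta_mx i i.
Proof.
have row_e3 : row_of_vec R (0, 0, 1) = delta_mx 0 ord_max.
  by apply/matrixP=> a [[|[|[|]]] ?] //; rewrite !ord1 !mxE.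
have frame_e3 : basis_frame i *m delta_mx ord_max 0 = delta_mx i 0 :> 'cV__.
  rewrite -colE; apply/matrixP=> a b.
  by rewrite !mxE tpermL ord1 eqxx andbT.
rewrite /mx_of_proj /= /dilate /line /= invr1 scale1r.
rewrite row_e3 trmx_delta mulmxA frame_e3.
rewrite -mulmxA -[X in _ *m X](_ : (basis_frame i *m delta_mx ord_max 0)^t* = _).
  by rewrite frame_e3 trmx_delta map_delta_mx mul_delta_mx.
by rewrite trmx_mul trmx_delta map_mxM map_delta_mx.
Qed.

Context (L : locale) (v : Proj R n -> L) (hv : is_valuation v).

Lemma valuation_axis i :
  loc_le (v (ray (basis_frameP i) (0, 0, 1))) (loc_bot L).
Proof. exact: ray_bot. Qed.

(** Partial sums of the projections onto the standard basis vectors: by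
    additivity v sends each of them to the bottom element, and the n-th is 1. *)
Definition coord_mx (k : nat) : 'M[C]_n := diag_mx (\row_i (i < k)%:R).

Lemma coord_mxP k : is_proj (coord_mx k).
Proof.
apply/is_projP; split; rewrite /coord_mx.
  rewrite tr_diag_mx map_diag_mx; congr diag_mx.
  by apply/matrixP=> i j; rewrite !mxE rmorph_nat.
rewrite mulmx_diag; congr diag_mx; apply/matrixP=> i j.
by rewrite !mxE -natrM mulnb andbb.
Qed.

Definition coord_proj k : Proj R n := exist _ _ (coord_mxP k).

Lemma valuation_trivial : loc_le (loc_top L) (loc_bot L).
Proof.
have bot k : (k <= n)%N -> loc_le (v (coord_proj k)) (loc_bot L).
  elim: k => [_|k IHk kn].
    rewrite -(valuation0 hv) (_ : coord_proj 0 = pzero); first exact: loc_refl.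
    apply: proj_eq; apply/matrixP=> i j.
    by rewrite /mx_of_proj /= !mxE mul0rn.
  pose i := Ordinal kn.
  rewrite (valuation_add hv (p := coord_proj k)
    (q := ray (basis_frameP i) (0, 0, 1))).
  - apply/loc_join_le; split; first exact: IHk (ltnW kn).
    exact: valuation_axis.
  - rewrite ray_basis_frame; apply/matrixP=> a b.
    rewrite /mx_of_proj /= mul_diag_mx !mxE.
    by case: eqP => [->|_]; rewrite ?ltnn ?mul0r ?mulr0.
  - rewrite ray_basis_frame; apply/matrixP=> a b.
    rewrite /mx_of_proj /= !mxE.
    have [<-|ab] := eqVneq a b.
      by rewrite andbb !mulr1n -natrD ltnS -(inj_eq val_inj) /=; case: ltngtP.
    rewrite !mulr0n; case: andP => [[/eqP ai /eqP bi]|_]; last by rewrite addr0.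
    by rewrite ai bi eqxx in ab.
rewrite -(valuation1 hv) (_ : pone = coord_proj n); first exact: bot.
apply: proj_eq; apply/matrixP=> i j.
by rewrite /mx_of_proj /= !mxE ltn_ord.
Qed.

End Collapse.

Theorem corollary7p1 (R : realType) (n : nat) (hn : (3 <= n)%N)
    (F : functor (opposite PBoolean) Loc)
    (hF : naturally_isomorphic
            (functor_comp F (functor_op Boolean_incl)) Stone) :
  is_initial (F (Proj R n)) /\ isomorphic (F (Proj R n)) (opens void).
Proof.
have [eta [_ eta_natural]] := hF.
have hv := spectrum_open_valuation eta_natural (Proj R n).
have iF : is_initial (F (Proj R n)).
  exact: trivial_locale_initial (valuation_trivial hn hv).
split=> //; apply: initial_isomorphic iF _.
exact: trivial_locale_initial opens_void_trivial.
Qed.
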